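(* Let $A\in\mathbb{R}^{n\times n}$ be symmetric positive semidefinite, let $B\in\mathbb{R}^{n\times n}$ be symmetric positive definite, let $P\in\mathbb{R}^{n\times n}$ be invertible, and let $\alpha>0$. Put $f(x)=x^TBx-(x^TAx)^{1/2}$, $\tilde A=P^{-T}AP^{-1}$, $\tilde B=P^{-T}BP^{-1}$. Let $x_k\in\mathbb{R}^n$ with $Ax_k\neq 0$, and let $x_{k+1}$ be given by $$y_k=Px_k,\qquad y_{k+1}=y_k-\alpha\left(2\tilde By_k-\frac{\tilde Ay_k}{(y_k^T\tilde Ay_k)^{1/2}}\right),\qquad x_{k+1}=P^{-1}y_{k+1}.$$ Then this iteration is a mirror descent step with mirror map $\Phi(x)=\frac12x^TP^TPx$, that is, $$x_{k+1}=\arg\min_{x\in\mathbb{R}^n}\ \alpha\nabla f(x_k)^Tx+D_\Phi(x,x_k).$$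
   Context: $D_\Phi(x,y)=\Phi(x)-\Phi(y)-\nabla\Phi(y)^T(x-y)$ is the Bregman divergence associated with $\Phi$. On $\{x:Ax\neq0\}$ the gradient of $f$ is $\nabla f(x)=2Bx-\dfrac{Ax}{(x^TAx)^{1/2}}$. $P^{-T}$ denotes $(P^{-1})^T$. *)

(* Defs.v *)
From HB Require Import structures.
From mathcomp Require Import all_boot all_order all_algebra.
From mathcomp Require Import all_classical all_reals all_analysis.

Set Implicit Arguments.
Unset Strict Implicit.
Unset Printing Implicit Defensive.

Import Order.TTheory GRing.Theory Num.Theory.
Import numFieldNormedType.Exports.

Local Open Scope classical_set_scope.
Local Open Scope ring_scope.

Definition dotv (R : realType) (n : nat) (u v : 'cV[R]_n) : R :=
  (u^T *m v) 0 0.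

Definition qform (R : realType) (n : nat) (M : 'M[R]_n) (x : 'cV[R]_n) : R :=
  (x^T *m M *m x) 0 0.

Definition sym_psd (R : realType) (n : nat) (M : 'M[R]_n) : Prop :=
  M \is symmetricmx /\ forall x : 'cV[R]_n, 0 <= qform M x.

Definition sym_pd (R : realType) (n : nat) (M : 'M[R]_n) : Prop :=
  M \is symmetricmx /\ forall x : 'cV[R]_n, x != 0 -> 0 < qform M x.

(* Column vector of partial derivatives. As ['D_v g x] is total, this is the
   gradient only at points where [g] is differentiable. *)
Definition gradient (R : realType) (n : nat) (g : 'cV[R]_n -> R)
    (x : 'cV[R]_n) : 'cV[R]_n :=
  \col_i 'D_(delta_mx i 0) g x.

Definition bregman (R : realType) (n : nat) (Phi : 'cV[R]_n -> R)
    (x y : 'cV[R]_n) : R :=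
  Phi x - Phi y - dotv (gradient Phi y) (x - y).

(* The set of all global minimizers: [x = argmin F], with the unique minimizer
   intended, is rendered as [argmin F = [set x]]. *)
Definition argmin (R : realType) (n : nat) (F : 'cV[R]_n -> R)
    : set 'cV[R]_n :=
  [set x | forall z, F x <= F z].

Definition mirror_descent_step (R : realType) (n : nat)
    (Phi g : 'cV[R]_n -> R) (alpha : R) (x x' : 'cV[R]_n) : Prop :=
  argmin (fun z => alpha * dotv (gradient g x) z + bregman Phi z x) = [set x'].

Definition objective (R : realType) (n : nat) (A B : 'M[R]_n)
    (x : 'cV[R]_n) : R :=
  qform B x - Num.sqrt (qform A x).

Definition mirror_map (R : realType) (n : nat) (P : 'M[R]_n)
    (x : 'cV[R]_n) : R :=
  2^-1 * qform (P^T *m P) x.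

(* Main.v *)
Require Import Defs.
From HB Require Import structures.
From mathcomp Require Import all_boot all_order all_algebra.
From mathcomp Require Import all_classical all_reals all_analysis.
From mathcomp Require Import ring lra.

Set Implicit Arguments.
Unset Strict Implicit.
Unset Printing Implicit Defensive.

Import Order.TTheory GRing.Theory Num.Theory.
Import numFieldNormedType.Exports.

Local Open Scope ring_scope.

(** The function minimized in the step is a quadratic with Hessian [P^T *m P], positive definite
    because [P] is invertible, so its unique minimizer is the point where its gradient vanishes
    ([mirror_descent_step_quadratic]). That condition reads [P^T P x' = P^T P x - alpha grad f(x)],
    which is the gradient step in the variable [y = P x] multiplied by [P^T]: the congruence by
    [invmx P] cancels and turns [At], [Bt] back into [A], [B]. The explicit form of [grad f]
    ([gradient_objective]) needs [x^T A x > 0], which [psd_qform_gt0] extracts from [A x != 0]. *)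

Lemma symmetricmx_tr (R : realType) (n : nat) (M : 'M[R]_n) :
  M \is symmetricmx -> M^T = M.
Proof.
rewrite qualifE /= expr0 scale1r => /eqP {2}->.
by apply/matrixP => i j; rewrite !mxE.
Qed.

Lemma dotvDl (R : realType) (n : nat) (u v w : 'cV[R]_n) :
  dotv (u + v) w = dotv u w + dotv v w.
Proof. by rewrite /dotv linearD mulmxDl mxE. Qed.

Lemma dotvZl (R : realType) (n : nat) (a : R) (u v : 'cV[R]_n) :
  dotv (a *: u) v = a * dotv u v.
Proof. by rewrite /dotv linearZ -scalemxAl mxE. Qed.

Lemma dotvC (R : realType) (n : nat) (u v : 'cV[R]_n) : dotv u v = dotv v u.
Proof.
by rewrite /dotv -[u^T *m v]trmxK trmx_mul trmxK [LHS]mxE.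
Qed.

Lemma dotvDr (R : realType) (n : nat) (u v w : 'cV[R]_n) :
  dotv u (v + w) = dotv u v + dotv u w.
Proof. by rewrite dotvC dotvDl ![dotv u _]dotvC. Qed.

Lemma dotvZr (R : realType) (n : nat) (a : R) (u v : 'cV[R]_n) :
  dotv u (a *: v) = a * dotv u v.
Proof. by rewrite dotvC dotvZl dotvC. Qed.

Lemma dotv_delta (R : realType) (n : nat) (i : 'I_n) (u : 'cV[R]_n) :
  dotv (delta_mx i 0) u = u i 0.
Proof. by rewrite /dotv trmx_delta -rowE mxE. Qed.

Lemma dotvv_gt0 (R : realType) (n : nat) (u : 'cV[R]_n) :
  u != 0 -> 0 < dotv u u.
Proof.
move=> u0.
have dotvvE : dotv u u = \sum_i u i 0 ^+ 2.
  by rewrite /dotv mxE; apply: eq_bigr => i _; rewrite mxE expr2.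
rewrite dotvvE lt_neqAle sumr_ge0 ?andbT => [|i _]; last exact: sqr_ge0.
apply: contra u0 => /eqP /esym /psumr_eq0P uu0.
apply/eqP/colP => i; rewrite mxE; apply/eqP; rewrite -sqrf_eq0.
by rewrite uu0 // => j _; exact: sqr_ge0.
Qed.

Lemma qformE (R : realType) (n : nat) (M : 'M[R]_n) (x : 'cV[R]_n) :
  qform M x = dotv x (M *m x).
Proof. by rewrite /qform /dotv mulmxA. Qed.

Lemma dotv_mulmx (R : realType) (n : nat) (M : 'M[R]_n) (x y : 'cV[R]_n) :
  dotv x (M *m y) = dotv (M^T *m x) y.
Proof. by rewrite /dotv trmx_mul trmxK mulmxA. Qed.

Lemma qform_congr (R : realType) (n : nat) (M P : 'M[R]_n) (x : 'cV[R]_n) :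
  qform (P^T *m M *m P) x = qform M (P *m x).
Proof. by rewrite !qformE -!mulmxA dotv_mulmx trmxK. Qed.

(** Symmetry merges the two cross terms. The gradients, the positivity of [x^T A x] and the
    minimality gap are all read off this expansion. *)
Lemma qform_line (R : realType) (n : nat) (M : 'M[R]_n) (x v : 'cV[R]_n)
    (h : R) : M^T = M ->
  qform M (h *: v + x) =
  qform M x + h * (2 * dotv v (M *m x)) + h ^+ 2 * qform M v.
Proof.
move=> Msym; rewrite !qformE mulmxDr -scalemxAr !(dotvDl, dotvDr, dotvZl, dotvZr).
have -> : dotv x (M *m v) = dotv v (M *m x) by rewrite dotv_mulmx Msym dotvC.
by ring.
Qed.

(* Moving from x along - A x would make the form negative if x^T A x = 0. *)
Lemma psd_qform_gt0 (R : realType) (n : nat) (A : 'M[R]_n) (x : 'cV[R]_n) :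
  sym_psd A -> A *m x != 0 -> 0 < qform A x.
Proof.
move=> [/symmetricmx_tr Asym A0] Ax0.
rewrite lt_neqAle A0 andbT; apply/negP => /eqP qx0.
have s0 := dotvv_gt0 Ax0; have c0 := A0 (A *m x).
set s := dotv _ _ in s0; set c := qform A _ in c0.
have c1 : 0 < c + 1 by lra.
(* If [qform A x = 0], the form at [x - t A x] is [- 2 t s + t^2 c]. The choice [t = s / (c + 1)]
   makes it negative, and the [+ 1] avoids dividing by [c = 0]. *)
have := A0 (- (s / (c + 1)) *: (A *m x) + x).
rewrite (qform_line _ _ _ Asym) -qx0 -/s -/c leNgt => /negP; apply.
rewrite (_ : _ + _ = - ((s / (c + 1)) ^+ 2 * (c + 2))); last first.
  by field; rewrite gt_eqF.
by rewrite oppr_lt0 mulr_gt0 ?exprn_gt0 ?divr_gt0 //; lra.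
Qed.

(** Both derivatives are limits of the same difference quotient, so partial derivatives reduce to
    one-variable calculus at [0]. *)
Lemma derive_line (R : realType) (n : nat) (g : 'cV[R]_n -> R)
    (x v : 'cV[R]_n) (d : R) :
  is_derive (0 : R) 1 (fun h : R => g (h *: v + x)) d -> 'D_v g x = d.
Proof.
move=> gd; rewrite -(@derive_val _ _ _ _ _ _ _ gd) /derive.
set q := fun h => _; set q' := fun h => _; suff -> : q = q' by [].
apply/funext => h; rewrite /q /q' /=.
by rewrite addr0 scale0r add0r [h *: 1]mulr1.
Qed.

Lemma is_derive_quadratic (R : realType) (a b c : R) :
  is_derive (0 : R) 1 (fun h : R => a + h * b + h ^+ 2 * c) b.
Proof.
have -> : (fun h : R => a + h * b + h ^+ 2 * c) =
  cst a + (b *: (@id R)) + (c *: (@id R) ^+ 2).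
  by apply/funext => h /=; rewrite !fctE /= [b *: _]mulrC [c *: _]mulrC.
apply: is_derive_eq.
by rewrite add0r expr1 mulr0 scale0r scaler0 addr0 [_ *: _]mulr1.
Qed.

Lemma gradient_mirror_map (R : realType) (n : nat) (P : 'M[R]_n)
    (x : 'cV[R]_n) : gradient (mirror_map P) x = P^T *m P *m x.
Proof.
set M := P^T *m P; have Msym : M^T = M by rewrite trmx_mul trmxK.
apply/colP => i; rewrite mxE -dotv_delta; apply: derive_line.
set v := delta_mx i 0; set b := dotv v _.
have -> : (fun h : R => mirror_map P (h *: v + x)) = (fun h =>
    2^-1 * qform M x + h * b + h ^+ 2 * (2^-1 * qform M v)).
  by apply/funext => h; rewrite /mirror_map (qform_line _ _ _ Msym) -/b; field.
exact: is_derive_quadratic.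
Qed.

(** Along each coordinate line both forms are quadratic polynomials; positivity of [qform A x] keeps
    the square root differentiable, so the chain rule applies. *)
Lemma gradient_objective (R : realType) (n : nat) (A B : 'M[R]_n)
    (x : 'cV[R]_n) : A^T = A -> B^T = B -> 0 < qform A x ->
  gradient (objective A B) x =
  2 *: (B *m x) - (Num.sqrt (qform A x))^-1 *: (A *m x).
Proof.
move=> Asym Bsym qx0; apply/colP => i; rewrite mxE -dotv_delta.
set v := delta_mx i 0; rewrite -scaleNr dotvDr !dotvZr.
apply: derive_line.
pose q (M : 'M[R]_n) (h : R) :=
  qform M x + h * (2 * dotv v (M *m x)) + h ^+ 2 * qform M v.
have -> : (fun h : R => objective A B (h *: v + x)) = q B - (Num.sqrt \o q A).
  apply/funext => h; rewrite /objective (qform_line _ _ _ Asym).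
  by rewrite (qform_line _ _ _ Bsym).
have dB : is_derive (0 : R) 1 (q B) (2 * dotv v (B *m x)).
  exact: is_derive_quadratic.
have dA : is_derive (0 : R) 1 (q A) (2 * dotv v (A *m x)).
  exact: is_derive_quadratic.
have q0 : q A 0 = qform A x by rewrite /q mul0r expr0n mul0r !addr0.
have dsqrt : is_derive (q A 0) 1 Num.sqrt (2 * Num.sqrt (q A 0))^-1.
  by apply: is_derive1_sqrt; rewrite q0.
have dAsqrt := is_derive1_comp dsqrt dA.
apply: is_derive_eq.
rewrite q0; field.
by rewrite gt_eqF // sqrtr_gt0.
Qed.

(* The objective of the step is a quadratic with Hessian P^T P whose gradient
   vanishes at x'. *)
Lemma mirror_descent_step_quadratic (R : realType) (n : nat) (P : 'M[R]_n)
    (g : 'cV[R]_n -> R) (alpha : R) (x x' : 'cV[R]_n) :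
  P \in unitmx ->
  P^T *m P *m x' = P^T *m P *m x - alpha *: gradient g x ->
  mirror_descent_step (mirror_map P) g alpha x x'.
Proof.
move=> Punit stat; set M := P^T *m P in stat.
have Msym : M^T = M by rewrite trmx_mul trmxK.
have qME d : qform M d = dotv (P *m d) (P *m d).
  by rewrite qformE -mulmxA dotv_mulmx trmxK.
rewrite /mirror_descent_step; set F := fun z => _.
(* Completing the square at [x']: [stat] cancels the part linear in [z - x'], leaving an exact
   gap. *)
have gapE z : F z = F x' + 2^-1 * qform M (z - x').
  rewrite -{1}[z](subrK x'); move: (z - x') => d.
  rewrite /F /bregman gradient_mirror_map /mirror_map -/M.
  rewrite -[d in qform M (d + _)]scale1r (qform_line _ _ _ Msym) stat.
  rewrite -scaleNr -addrA !(dotvDl, dotvDr, dotvZl, dotvZr).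
  by rewrite (dotvC d (M *m x)) (dotvC d (gradient g x)); field.
(* The gap is half the squared norm of [P (z - x')]: never negative, and zero only at [z = x'] by
   invertibility of [P]. *)
apply/seteqP; split => [z /(_ x')|_ -> z] /=; rewrite (gapE z); last first.
  rewrite lerDl mulr_ge0 ?invr_ge0 ?ler0n // qME.
  by have [->|/dotvv_gt0/ltW//] := eqVneq (P *m (z - x')) 0;
    rewrite /dotv mulmx0 mxE.
rewrite gerDl pmulr_rle0 ?invr_gt0 ?ltr0n // qME.
have [Pd0 _|/dotvv_gt0 d0] := eqVneq (P *m (z - x')) 0; last first.
  by rewrite leNgt d0.
by apply/eqP; rewrite -subr_eq0 -(mulKmx Punit (z - x')) Pd0 mulmx0.
Qed.

Theorem theorem3p9 (R : realType) (n : nat) (A B P At Bt : 'M[R]_n) (alpha : R)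
    (xk xk1 yk yk1 : 'cV[R]_n)
    (hA : sym_psd A) (hB : sym_pd B) (hP : P \in unitmx) (halpha : 0 < alpha)
    (hAt : At = (invmx P)^T *m A *m invmx P)
    (hBt : Bt = (invmx P)^T *m B *m invmx P)
    (hxk : A *m xk != 0)
    (hyk : yk = P *m xk)
    (hyk1 : yk1 = yk - alpha *: (2 *: (Bt *m yk)
                                 - (Num.sqrt (qform At yk))^-1 *: (At *m yk)))
    (hxk1 : xk1 = invmx P *m yk1) :
  mirror_descent_step (mirror_map P) (objective A B) alpha xk xk1.
Proof.
apply: mirror_descent_step_quadratic => //.
have [[/symmetricmx_tr Asym _] [/symmetricmx_tr Bsym _]] := (hA, hB).
rewrite gradient_objective //; last exact: psd_qform_gt0.
have pullback (C : 'M[R]_n) :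
    P^T *m ((invmx P)^T *m C *m invmx P *m (P *m xk)) = C *m xk.
  by rewrite -!mulmxA mulKmx // !mulmxA -trmx_mul mulVmx // trmx1 mul1mx.
(* The normalizing square root is the same in both coordinates. *)
have qAt : qform At yk = qform A xk by rewrite hAt hyk qform_congr mulKmx.
rewrite hxk1 -mulmxA mulKVmx // hyk1 qAt hyk hAt hBt.
by rewrite mulmxBr -scalemxAr mulmxBr -!scalemxAr !pullback mulmxA.
Qed.
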